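(* Let $A=(a_{ij})$ be an $m\times n$ matrix with all entries positive, let $p=(p_i)$ be a nonzero vector in $\mathbb{R}_+^m$, and let $q=(q_j)$ be a vector in $\mathbb{R}_+^n$ with all entries positive. Put $\Delta=q^{-}A^{-}p$ (max-algebraic product). Consider the problem of maximizing $q^{-}x(Ax)^{-}p$ over all vectors $x=(x_j)\in\mathbb{R}_+^n$ with all entries positive. Then the optimal (maximum) value of this problem equals $\Delta$. Moreover, a positive vector $x$ is a solution (i.e. attains the maximum) if and only if there exist indices $k\in\{1,\dots,n\}$ and $l\in\{1,\dots,m\}$ with $$q_k^{-1}a_{lk}^{-1}p_l=\Delta$$ such that $$\bigoplus_{j=1}^{n}a_{lj}x_j=a_{lk}x_k .$$
   Context: All operations are in the max-algebra (tropical algebra) on the nonnegative reals $\mathbb{R}_+=[0,\infty)$: addition is $a\oplus b=\max(a,b)$, with $\bigoplus$ denoting the corresponding finite maximum, and multiplication is ordinary multiplication. Matrix and vector products are defined by the usual rules with $+$ replaced by $\oplus$, e.g. $(Ax)_i=\max_j a_{ij}x_j$. A vector or matrix is positive if all its entries are positive. The conjugate transpose of a nonzero $m\times n$ matrix $A=(a_{ij})$ is the $n\times m$ matrix $A^{-}=(a^{-}_{ij})$ with $a^{-}_{ij}=a_{ji}^{-1}$ if $a_{ji}\neq 0$ and $a^{-}_{ij}=0$ otherwise. For a nonzero column vector $x$, $x^{-}$ is the row vector with entries $x_i^{-1}$ if $x_i\ne 0$ and $0$ otherwise. Thus, for a positive $m\times n$ matrix $A=(a_{ij})$, a nonzero vector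 $p=(p_i)\in\mathbb{R}_+^m$, a positive vector $q=(q_j)\in\mathbb{R}_+^n$ and a positive vector $x=(x_j)\in\mathbb{R}_+^n$, $$q^{-}x(Ax)^{-}p=\Big(\max_{j}q_j^{-1}x_j\Big)\Big(\max_{i}(Ax)_i^{-1}p_i\Big),\qquad q^{-}A^{-}p=\max_{i,j}q_j^{-1}a_{ij}^{-1}p_i.$$ *)

(* Defs.v *)
From HB Require Import structures.
From mathcomp Require Import all_boot all_order all_algebra.
From mathcomp Require Import reals.
Set Implicit Arguments.
Unset Strict Implicit.
Unset Printing Implicit Defensive.
Import Order.TTheory GRing.Theory Num.Theory.
Local Open Scope ring_scope.

Definition posmx (R : realType) (m n : nat) (A : 'M[R]_(m, n)) : Prop :=
  forall i j, 0 < A i j.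

Definition nnegmx (R : realType) (m n : nat) (A : 'M[R]_(m, n)) : Prop :=
  forall i j, 0 <= A i j.

(* Max-algebra matrix product. It is meant for nonnegative matrices: 0 is      *)
(* neutral for max (hence harmless as the default of the big max) only there.  *)
Definition maxmulmx (R : realType) (m n r : nat)
    (A : 'M[R]_(m, n)) (B : 'M[R]_(n, r)) : 'M[R]_(m, r) :=
  \matrix_(i, k) \big[Num.max/0]_(j < n) (A i j * B j k).

Notation "A ⊗ B" := (maxmulmx A B) (at level 40, left associativity) : ring_scope.

(* Used for matrices and, with n = 1, for column vectors. *)
Definition conjtr (R : realType) (m n : nat) (A : 'M[R]_(m, n)) : 'M[R]_(n, m) :=
  \matrix_(i, j) if A j i != 0 then (A j i)^-1 else 0.

Definition max_value (R : realType) (T : Type)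
    (D : T -> Prop) (f : T -> R) (v : R) : Prop :=
  (exists2 x, D x & f x = v) /\ (forall x, D x -> f x <= v).

Definition maximizer (R : realType) (T : Type)
    (D : T -> Prop) (f : T -> R) (x : T) : Prop :=
  D x /\ (forall y, D y -> f y <= f x).

(* Both products below are 1 x 1 matrices, read off as scalars. *)
Definition objective (R : realType) (m n : nat)
    (A : 'M[R]_(m, n)) (p : 'cV[R]_m) (q x : 'cV[R]_n) : R :=
  (conjtr q ⊗ x ⊗ conjtr (A ⊗ x) ⊗ p) 0 0.

Definition Delta (R : realType) (m n : nat)
    (A : 'M[R]_(m, n)) (p : 'cV[R]_m) (q : 'cV[R]_n) : R :=
  (conjtr q ⊗ conjtr A ⊗ p) 0 0.

(* Main.v *)
Require Import Defs.
From HB Require Import structures.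
From mathcomp Require Import all_boot all_order all_algebra.
From mathcomp Require Import reals.
Set Implicit Arguments.
Unset Strict Implicit.
Unset Printing Implicit Defensive.
Import Order.TTheory GRing.Theory Num.Theory.
Local Open Scope ring_scope.

(* Distributing the two maxima, the objective is the maximum over (k, l) of    *)
(* q_k^-1 x_k (Ax)_l^-1 p_l. Since (Ax)_l >= a_lk x_k, each of these is at     *)
(* most q_k^-1 a_lk^-1 p_l, hence at most Delta. As Delta > 0, equality at     *)
(* (k, l) means both that (k, l) attains Delta and that (Ax)_l = a_lk x_k.     *)
(* The vector with x_j = a_lj^-1 makes row l satisfy this for every k.         *)

(** The comparison rests on one factorization, [objective_termE]: a term of the objective is a term
    of [Delta] times the ratio a_lk x_k / (Ax)_l, which is at most 1. This yields the upper bound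
    [objective_le], and its equality case [objective_eq_Delta]. [objective_max] shows that the bound
    is reached, so that maximizing means having value [Delta]. *)

Lemma nnegmx_maxmulmx (R : realType) (m n r : nat)
    (A : 'M[R]_(m, n)) (B : 'M[R]_(n, r)) : nnegmx (A ⊗ B).
Proof. by move=> i k; rewrite mxE bigmax_ge_id. Qed.

Lemma posmx_nnegmx (R : realType) (m n : nat) (A : 'M[R]_(m, n)) :
  posmx A -> nnegmx A.
Proof. by move=> hA i j; rewrite ltW. Qed.

(* The case split in [conjtr] is absorbed by the convention 0^-1 = 0. *)
Lemma conjtrE (R : realType) (m n : nat) (A : 'M[R]_(m, n)) i j :
  conjtr A i j = (A j i)^-1.
Proof. by rewrite mxE; case: eqP => // ->; rewrite invr0. Qed.

Lemma nnegmx_conjtr (R : realType) (m n : nat) (A : 'M[R]_(m, n)) :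
  nnegmx A -> nnegmx (conjtr A).
Proof. by move=> hA i j; rewrite conjtrE invr_ge0. Qed.

Lemma maxmulmx_ge (R : realType) (m n r : nat)
    (A : 'M[R]_(m, n)) (B : 'M[R]_(n, r)) i j k :
  A i j * B j k <= (A ⊗ B) i k.
Proof. by rewrite mxE (le_bigmax _ (fun j => A i j * B j k)). Qed.

(** Nonnegativity keeps the default 0 of the big max from exceeding every term, and [0 < n] provides
    at least one term. *)
Lemma maxmulmx_attained (R : realType) (m n r : nat)
    (A : 'M[R]_(m, n)) (B : 'M[R]_(n, r)) i k :
  (0 < n)%N -> nnegmx A -> nnegmx B ->
  exists j, (A ⊗ B) i k = A i j * B j k.
Proof.
case: n => // n in A B *; move=> _ hA hB; rewrite mxE.
have [|j _ ->] := @eq_bigmax _ _ _ 0 ord0 predT (fun j => A i j * B j k) isT.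
  by move=> j _; rewrite mulr_ge0.
by exists j.
Qed.

Section Objective.
Variables (R : realType) (m n : nat) (A : 'M[R]_(m, n)) (p : 'cV[R]_m).
Variable q : 'cV[R]_n.
Hypotheses (hm : (0 < m)%N) (hn : (0 < n)%N).
Hypotheses (hA : posmx A) (hp : nnegmx p) (hp0 : p != 0) (hq : posmx q).

Let hq' : nnegmx (conjtr q).
Proof. exact/nnegmx_conjtr/posmx_nnegmx. Qed.

Lemma term_ge0 k l : 0 <= (q k 0)^-1 * (A l k)^-1 * p l 0.
Proof. by rewrite mulr_ge0 // ltW // mulr_gt0 ?invr_gt0. Qed.

Lemma Delta_ge k l : (q k 0)^-1 * (A l k)^-1 * p l 0 <= Delta A p q.
Proof.
apply: le_trans (maxmulmx_ge _ _ _ l _); apply: ler_wpM2r => //.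
by rewrite -!conjtrE maxmulmx_ge.
Qed.

Lemma Delta_attained :
  exists k l, (q k 0)^-1 * (A l k)^-1 * p l 0 = Delta A p q.
Proof.
have hA' : nnegmx (conjtr A) by exact/nnegmx_conjtr/posmx_nnegmx.
have [l El] := maxmulmx_attained 0 0 hm
  (nnegmx_maxmulmx (conjtr q) (conjtr A)) hp.
have [k Ek] := maxmulmx_attained 0 l hn hq' hA'.
by exists k, l; rewrite /Delta El Ek !conjtrE.
Qed.

(** A nonzero nonnegative [p] has a positive entry, whose terms in [Delta] are positive. This allows
    cancelling [Delta] in the equality case. *)
Lemma Delta_gt0 : 0 < Delta A p q.
Proof.
have [l pl] : exists l, 0 < p l 0.
  have /cV0Pn[l pl] := hp0.
  by exists l; rewrite lt_def pl hp.
apply: lt_le_trans (Delta_ge (Ordinal hn) l).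
by rewrite !mulr_gt0 ?invr_gt0.
Qed.

Lemma objective_ge (x : 'cV[R]_n) k l : posmx x ->
  (q k 0)^-1 * x k 0 * ((A ⊗ x) l 0)^-1 * p l 0 <= objective A p q x.
Proof.
move=> hx; apply: le_trans (maxmulmx_ge _ _ _ l _); apply: ler_wpM2r => //.
apply: le_trans (maxmulmx_ge _ _ _ 0 _); rewrite conjtrE.
apply: ler_wpM2r; first by rewrite invr_ge0 nnegmx_maxmulmx.
by rewrite -conjtrE maxmulmx_ge.
Qed.

Lemma objective_attained (x : 'cV[R]_n) : posmx x ->
  exists k l,
    objective A p q x = (q k 0)^-1 * x k 0 * ((A ⊗ x) l 0)^-1 * p l 0.
Proof.
move=> hx.
have hAx : nnegmx (conjtr (A ⊗ x)) by exact/nnegmx_conjtr/nnegmx_maxmulmx.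
have [l El] := maxmulmx_attained 0 0 hm
  (nnegmx_maxmulmx (conjtr q ⊗ x) (conjtr (A ⊗ x))) hp.
(* The product of the scalar [conjtr q ⊗ x] with a row has inner dimension 1, so this maximum has a
   single term and [i] is 0. *)
have [i Ei] := maxmulmx_attained 0 l (ltn0Sn 0)
  (nnegmx_maxmulmx (conjtr q) (x)) hAx.
have [k Ek] := maxmulmx_attained 0 i hn hq' (posmx_nnegmx hx).
exists k, l; rewrite /objective El Ei Ek !conjtrE.
by rewrite (ord1 i).
Qed.

Lemma maxmulmx_posmx_gt0 (x : 'cV[R]_n) l : posmx x -> 0 < (A ⊗ x) l 0.
Proof.
move=> hx; apply: lt_le_trans (maxmulmx_ge _ _ _ (Ordinal hn) _).
exact: mulr_gt0.
Qed.

(** Inserting a_lk^-1 a_lk next to x_k separates the part independent of [x] from the ratio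
    measuring how far column k is from attaining the maximum in row l. *)
Lemma objective_termE (x : 'cV[R]_n) k l :
  (q k 0)^-1 * x k 0 * ((A ⊗ x) l 0)^-1 * p l 0 =
  (q k 0)^-1 * (A l k)^-1 * p l 0 * (A l k * x k 0 / (A ⊗ x) l 0).
Proof.
rewrite -{1}[x k 0](mulKf (lt0r_neq0 (hA l k))) -!mulrA.
by congr (_ * (_ * _)); rewrite [RHS]mulrC !mulrA.
Qed.

Lemma objective_le (x : 'cV[R]_n) :
  posmx x -> objective A p q x <= Delta A p q.
Proof.
move=> hx; have [k [l ->]] := objective_attained hx.
rewrite objective_termE; apply: le_trans (Delta_ge k l).
apply: ler_piMr; first exact: term_ge0.
by rewrite ler_pdivrMr ?maxmulmx_posmx_gt0 // mul1r maxmulmx_ge.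
Qed.

Lemma objective_eq_Delta (x : 'cV[R]_n) : posmx x ->
  objective A p q x = Delta A p q <->
  exists k l, (q k 0)^-1 * (A l k)^-1 * p l 0 = Delta A p q /\
    (A ⊗ x) l 0 = A l k * x k 0.
Proof.
move=> hx; split=> [|[k [l [Ekl Ax]]]]; last first.
  apply/le_anti; rewrite objective_le //= -Ekl.
  apply: le_trans (objective_ge k l hx).
  by rewrite objective_termE Ax divff ?mulr1 // mulf_neq0 ?lt0r_neq0.
have [k [l ->]] := objective_attained hx; rewrite objective_termE.
set t := _ * p l 0; set r := _ / _ => Etr.
have t_le : t <= Delta A p q := Delta_ge k l.
have Ax0 := maxmulmx_posmx_gt0 l hx.
have r_le1 : r <= 1 by rewrite ler_pdivrMr // mul1r maxmulmx_ge.
(* Since r <= 1 and t >= 0, Delta = t r <= t <= Delta. *)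
have Et : t = Delta A p q.
  by apply/le_anti; rewrite t_le -Etr ler_piMr // term_ge0.
(* Now Delta r = Delta, and cancelling the positive [Delta] gives r = 1. *)
exists k, l; split=> //; apply/esym/divr1_eq.
by apply: (mulfI (lt0r_neq0 Delta_gt0)); rewrite mulr1 -{1}Et.
Qed.

Lemma objective_max :
  exists2 x : 'cV[R]_n, posmx x & objective A p q x = Delta A p q.
Proof.
have [k [l Ekl]] := Delta_attained.
(* All products a_lj x_j equal 1, so every column, in particular k, attains the maximum in row l. *)
pose x : 'cV[R]_n := \col_j (A l j)^-1.
have hx : posmx x by move=> j i; rewrite mxE invr_gt0.
have Ax j : A l j * x j 0 = 1 by rewrite mxE divff ?lt0r_neq0.
have [j Ej] := maxmulmx_attained l 0 hn (posmx_nnegmx hA) (posmx_nnegmx hx).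
by exists x => //; apply/objective_eq_Delta => //; exists k, l; rewrite Ej !Ax.
Qed.

End Objective.

Theorem theorem4p1 (R : realType) (m n : nat) (hm : (0 < m)%N) (hn : (0 < n)%N)
  (A : 'M[R]_(m, n)) (p : 'cV[R]_m) (q : 'cV[R]_n)
  (hA : posmx A) (hp : nnegmx p) (hp0 : p != 0) (hq : posmx q) :
  max_value (@posmx R n 1) (objective A p q) (Delta A p q) /\
  (forall x : 'cV[R]_n, posmx x ->
     (maximizer (@posmx R n 1) (objective A p q) x <->
      exists (k : 'I_n) (l : 'I_m),
        (q k 0)^-1 * (A l k)^-1 * p l 0 = Delta A p q /\
        \big[Num.max/0]_(j < n) (A l j * x j 0) = A l k * x k 0)).
Proof.
have obj_le := objective_le hm hn hA hp hq.
have [x0 hx0 Ex0] := objective_max hm hn hA hp hp0 hq.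
split=> [|x hx]; first by split=> //; exists x0.
have maxE : maximizer (@posmx R n 1) (objective A p q) x <->
    objective A p q x = Delta A p q.
  split=> [[_ x_max]|Ex]; last by split=> // y hy; rewrite Ex obj_le.
  by apply/le_anti; rewrite obj_le //= -Ex0 x_max.
apply: (iff_trans maxE).
apply: (iff_trans (objective_eq_Delta hm hn hA hp hp0 hq hx)).
by split=> -[k [l [Ekl Ax]]]; exists k, l; split=> //; rewrite -Ax mxE.
Qed.
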